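(* For $u,v,n \in \mathbb{N}$, let $C_3(u,v,n)$ denote the number of partitions of $n$ into $u$ distinct parts congruent to $1$ modulo $3$ and $v$ distinct parts congruent to $2$ modulo $3$ (all parts distinct). Let $D_3(u,v,n)$ denote the number of overpartitions $\lambda_1 + \cdots + \lambda_s$ of $n$ such that only parts congruent to $\pm 1 \pmod 6$ can be overlined, $\overline{1}$ is not a part, $u$ equals the number of non-overlined parts congruent to $0$ or $1$ modulo $3$ plus twice the number of overlined parts congruent to $5$ modulo $6$, and $v$ equals the number of non-overlined parts congruent to $0$ or $2$ modulo $3$ plus twice the number of overlined parts congruent to $1$ modulo $6$, and satisfying, for all $1\le i<s$, $$\lambda_i - \lambda_{i+1} \geq \begin{cases} 4 + \chi(\overline{\lambda_{i+1}}) & \text{if } \lambda_{i} \equiv 1, 2, 3, 5 \pmod 6 \text{ and } \lambda_i \text{ is not overlined} , \\ 5 + \chi(\overline{\lambda_{i+1}}) & \text{if } \lambda_{i} \equiv 0, 4 \pmod 6, \\ 6 + \chi(\overline{\lambda_{i+1}}) & \text{if } \lambda_{i} \equiv 1, 5 \pmod 6 \text{ and } \lambda_i \text{ is overlined}, \end{cases}$$ where $\chi(\overline{\lambda_{i+1}})=1$ if $\lambda_{i+1}$ is overlined and $0$ otherwise. Then $C_3(u,v,n)=D_3(u,v,n)$ for all $u,v,n\in\mathbb{N}$.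
   Context: An overpartition of $n$ is a partition of $n$ (into positive integers, listed in non-increasing order) in which the first occurrence of each part value may be overlined; an overlined part $\overline{m}$ has value $m$. *)

(* Defs.v *)
From mathcomp Require Import all_boot.
Set Implicit Arguments. Unset Strict Implicit. Unset Printing Implicit Defensive.

Definition is_C3 (u v n : nat) (s : seq nat) : bool :=
  [&& sorted (fun a b => b < a) s,
      all (fun m => m %% 3 != 0) s,
      count (fun m => m %% 3 == 1) s == u,
      count (fun m => m %% 3 == 2) s == v &
      sumn s == n].

(* Overpartition: parts are pairs (m, b), b = true iff overlined.
   Listed in non-increasing order of values; only the first occurrence of a
   value may be overlined (so within a block of equal values only the first
   entry can be overlined); all values positive. *)
Definition is_overpartition (s : seq (nat * bool)) : bool :=
  all (fun p => 0 < p.1) s &&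
  sorted (fun p q => (q.1 <= p.1) && ((p.1 == q.1) ==> ~~ q.2)) s.

Definition chi (b : bool) : nat := if b then 1 else 0.

Definition gap3 (p q : nat * bool) : nat :=
  (if (p.1 %% 6 == 0) || (p.1 %% 6 == 4) then 5
   else if p.2 then 6 else 4) + chi q.2.

Definition is_D3 (u v n : nat) (s : seq (nat * bool)) : bool :=
  [&& is_overpartition s,
      all (fun p => p.2 ==> ((p.1 %% 6 == 1) || (p.1 %% 6 == 5))) s,
      (1, true) \notin s,
      count (fun p => ~~ p.2 && ((p.1 %% 3 == 0) || (p.1 %% 3 == 1))) s
        + 2 * count (fun p => p.2 && (p.1 %% 6 == 5)) s == u,
      count (fun p => ~~ p.2 && ((p.1 %% 3 == 0) || (p.1 %% 3 == 2))) s
        + 2 * count (fun p => p.2 && (p.1 %% 6 == 1)) s == v,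
      sorted (fun p q => gap3 p q + q.1 <= p.1) s &
      sumn (map fst s) == n].

(* Counting: every (over)partition of n has at most n parts, each of size <= n,
   so it is the image of a unique k-tuple over 'I_n.+1 (resp. 'I_n.+1 * bool)
   with k <= n.  Distinct tuples give distinct sequences. *)
Definition C3 (u v n : nat) : nat :=
  \sum_(k < n.+1)
    #|[set t : k.-tuple 'I_n.+1 | is_C3 u v n (map val t)]|.

Definition D3 (u v n : nat) : nat :=
  \sum_(k < n.+1)
    #|[set t : k.-tuple ('I_n.+1 * bool)
         | is_D3 u v n (map (fun p => (val p.1, p.2)) t)]|.

(* Main.v *)
Require Import Defs.
From mathcomp Require Import all_boot.
From mathcomp Require Import all_algebra zify ring.
Import GRing.Theory.

(** Let [G_m(a,b)] be the generating function, with weight [a^u b^v q^n], of the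
    sequences counted by [D3] whose largest part is at most [m] and is not an
    overlined [m]. Conditioning on the largest part gives linear recurrences for
    [G_m] of period 6 in [m]. They imply, by induction on [k], the exact identity
      [G_(6k+3)(a, b) = (1 + a q) G_(6k+1)(b q, a q^2)].
    As [G_m] stabilises modulo any power of [q], its limit satisfies
    [G(a, b) = (1 + a q) (1 + b q^2) G(a q^3, b q^3)], which iterates to the product
    of the [(1 + a q^(3i+1)) (1 + b q^(3i+2))], the generating function of [C3]. *)

(** * Counting tuples of all lengths inside one duplicate-free list *)

(** Each [s] in [L] satisfying [P] is the image of exactly one tuple, as [f] is injective, and so
    contributes only to the summand [k = size s]. Exchanging the two sums gives the count. *)
Lemma sum_card_tuple (T : finType) (U : eqType) (f : T -> U)
    (P : pred (seq U)) (L : seq (seq U)) (n : nat) :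
  injective f -> uniq L ->
  (forall t, P (map f t) -> map f t \in L) ->
  (forall s, s \in L -> P s -> size s <= n /\ exists t, s = map f t) ->
  \sum_(k < n.+1) #|[set t : k.-tuple T | P (map f t)]| = count P L.
Proof.
move=> f_inj uL PL LP.
have cardE (k : nat) : #|[set t : k.-tuple T | P (map f t)]|
    = count (fun s => P s && (size s == k)) L.
  rewrite cardE -size_filter.
  rewrite -(size_map (fun t : k.-tuple T => map f t)).
  apply: perm_size; apply: uniq_perm.
  - rewrite map_inj_uniq ?enum_uniq // => t1 t2 /(inj_map f_inj) E.
    exact: val_inj.
  - exact: filter_uniq.
  move=> s; rewrite mem_filter; apply/mapP/idP.
    case=> t; rewrite mem_enum inE => Pt ->.
    by rewrite Pt size_map size_tuple eqxx PL.
  case/andP=> /andP[Ps /eqP ks] sL; have [_ [t st]] := LP _ sL Ps.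
  have tk : size t == k by rewrite -ks st size_map.
  by exists (Tuple tk); rewrite // mem_enum inE /= -st.
under eq_bigr => k _ do rewrite cardE.
transitivity (\sum_(s <- L | P s) 1); last by rewrite sum1_count.
under eq_bigr => k _ do rewrite -sum1_count big_mkcondr.
rewrite exchange_big /= big_seq_cond [RHS]big_seq_cond.
apply: eq_bigr => s /andP[sL Ps]; have [sn _] := LP _ sL Ps.
rewrite (bigD1 (inord (size s))) //= inordK // eqxx big1 // => i iN.
case: eqP => // si; case/eqP: iN; apply: val_inj; rewrite /= inordK //.
Qed.

(** * Enumeration of the overpartitions counted by [D3] *)

Definition stat_u (s : seq (nat * bool)) : nat :=
  count (fun p => ~~ p.2 && ((p.1 %% 3 == 0) || (p.1 %% 3 == 1))) s
  + 2 * count (fun p => p.2 && (p.1 %% 6 == 5)) s.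

Definition stat_v (s : seq (nat * bool)) : nat :=
  count (fun p => ~~ p.2 && ((p.1 %% 3 == 0) || (p.1 %% 3 == 2))) s
  + 2 * count (fun p => p.2 && (p.1 %% 6 == 1)) s.

Definition overlinable (m : nat) : bool :=
  (1 < m) && ((m %% 6 == 1) || (m %% 6 == 5)).
Arguments overlinable : simpl never.

(** The share of [gap3 p q] that depends on [p] alone; the other share, [chi q.2], is carried by
    [head_le]. *)
Definition gap (p : nat * bool) : nat :=
  if (p.1 %% 6 == 0) || (p.1 %% 6 == 4) then 5 else if p.2 then 6 else 4.

(* Admits [(m, false)] but not [(m, true)], so that the gap condition below a part [p]
   reads [head_le (p.1 - gap p)]. *)
Definition head_le (m : nat) (s : seq (nat * bool)) : bool :=
  if s is p :: _ then p.1 + chi p.2 <= m else true.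

(** If [p.1 < gap p], the truncated difference is 0, and positivity of the parts then forces the
    tail to be empty, as the gap condition requires. *)
Fixpoint gap_chain (s : seq (nat * bool)) : bool :=
  if s is p :: s' then
    [&& 0 < p.1, p.2 ==> overlinable p.1, head_le (p.1 - gap p) s' & gap_chain s']
  else true.

(* [f] is fuel; any [f >= m] gives the same list. *)
Fixpoint chains_fuel (f m : nat) : seq (seq (nat * bool)) :=
  match f, m with
  | f'.+1, m'.+1 =>
      chains_fuel f' m'
      ++ (if overlinable m' then
            map (cons (m', true)) (chains_fuel f' (m' - 6)) else [::])
      ++ map (cons (m'.+1, false)) (chains_fuel f' (m'.+1 - gap (m'.+1, false)))
  | _, _ => [:: [::]]
  end.

Definition chains m := chains_fuel m m.

Lemma gap_ge4 p : 4 <= gap p.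
Proof. by rewrite /gap; case: ifP => // _; case: ifP. Qed.

Lemma chains_fuelE f m : m <= f -> chains_fuel f m = chains m.
Proof.
rewrite /chains; elim/ltn_ind: m f => -[|m] IH [|f] //= mf.
have g4 := gap_ge4 (m.+1, false).
by rewrite !(IH _ _ f, IH _ _ m) //; lia.
Qed.

(** In the order where overlined [m] lies strictly between [m] and [m.+1], raising the bound by one
    admits two new largest parts: overlined [m], whose gap is 6 because [m] is 1 or 5 modulo 6, and
    plain [m.+1]. *)
Lemma chainsS m : chains m.+1 =
  chains m ++ (if overlinable m then map (cons (m, true)) (chains (m - 6)) else [::])
  ++ map (cons (m.+1, false)) (chains (m.+1 - gap (m.+1, false))).
Proof.
have g4 := gap_ge4 (m.+1, false).
by rewrite {1}/chains /= !chains_fuelE //; lia.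
Qed.

Lemma mem_chains m s : (s \in chains m) = gap_chain s && head_le m s.
Proof.
elim/ltn_ind: m s => -[|m] IH s.
  case: s => [|p s] //=; rewrite inE /=; case: p => [[|p] [|]] //=;
  by rewrite ?andbF.
rewrite chainsS !mem_cat IH //.
have g4 := gap_ge4 (m.+1, false).
case: s => [|[p o] s] //.
have -> : ((p, o) :: s \in
    (if overlinable m then map (cons (m, true)) (chains (m - 6)) else [::]))
    = [&& p == m, o, overlinable m & gap_chain s && head_le (m - 6) s].
  case: ifP => om; last by rewrite !andbF.
  apply/mapP/idP => [[s' s'm [-> -> ->]]|].
    by rewrite ?om eqxx -IH //; lia.
  case/and4P=> /eqP-> ->  _ ; rewrite -IH ; last lia.
  by exists s.
have -> : ((p, o) :: s \in
    map (cons (m.+1, false)) (chains (m.+1 - gap (m.+1, false))))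
    = [&& p == m.+1, ~~ o & gap_chain s && head_le (m.+1 - gap (m.+1, false)) s].
  apply/mapP/idP => [[s' s'm [-> -> ->]]|].
    by rewrite ?om eqxx -IH //; lia.
  case/and3P=> /eqP-> /negbTE-> ; rewrite -IH ; last lia.
  by exists s.
rewrite /=.
case: o => /=; rewrite ?andbF ?orbF.
  rewrite addn1 ltnS /gap /=.
  have [->|] := eqVneq p m.
    rewrite ltnn leqnn !andbF /= andbT.
    case om: (overlinable m); rewrite ?andbF //=.
    have [m0 ->] : 0 < m /\ ((m %% 6 == 0) || (m %% 6 == 4)) = false.
      by move: om; rewrite /overlinable; lia.
    by rewrite m0 /= andbC.
  by move=> pm; rewrite orbF [p <= m]leq_eqVlt (negbTE pm).
rewrite addn0.
have [->|pm] := eqVneq p m.+1.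
  by rewrite ltnn leqnn !andbF /= andbT andbC.
by rewrite orbF [p <= m.+1]leq_eqVlt (negbTE pm).
Qed.

Lemma chains_uniq m : uniq (chains m).
Proof.
elim/ltn_ind: m => -[|m] IH //.
have g4 := gap_ge4 (m.+1, false).
have cons_inj p : injective (@cons (nat * bool) p) by move=> s1 s2 [].
rewrite chainsS !cat_uniq IH //= map_inj_uniq ?IH //; last lia.
rewrite andbT; apply/and3P; split.
- apply/hasPn=> s; rewrite mem_cat mem_chains => /orP[|/mapP[s' _ ->]].
    case: ifP => // _ /mapP[s' _ ->] /=.
    by rewrite addn1 ltnn !andbF.
  by rewrite /= addn0 ltnn !andbF.
- by case: ifP => //; rewrite map_inj_uniq ?IH //; lia.
apply/hasPn=> s /mapP[s' _ ->]; case: ifP => // _.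
by apply/mapP=> -[].
Qed.

(** Gaps of at least 4 make the values strictly decreasing, so the ordering and first-occurrence
    conditions on overpartitions hold automatically. *)
Lemma gap_chainE s : gap_chain s =
  [&& is_overpartition s,
      all (fun p => p.2 ==> ((p.1 %% 6 == 1) || (p.1 %% 6 == 5))) s,
      (1, true) \notin s &
      sorted (fun p q => gap3 p q + q.1 <= p.1) s].
Proof.
rewrite /is_overpartition.
elim: s => [|[p o] [|[p' o'] s] IH] //.
  by rewrite /= /overlinable inE xpair_eqE; case: o => /=; lia.
rewrite [gap_chain _]/= -/(gap_chain ((p', o') :: s)) IH.
rewrite !(in_cons, xpair_eqE) /= /gap3 -/(gap (p, o)) /overlinable /=.
have := gap_ge4 (p, o).
move: (gap (p, o)) (all _ s) (all _ s) (path _ _ s) (path _ _ s) (_ \in s).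
by case: o o' {IH} => [] [] g A B C D E /=; lia.
Qed.

(** * Enumeration of the partitions counted by [C3] *)

Fixpoint distinct_parts (m : nat) : seq (seq nat) :=
  if m is m'.+1 then
    distinct_parts m'
    ++ (if m'.+1 %% 3 == 0 then [::] else map (cons m'.+1) (distinct_parts m'))
  else [:: [::]].

Lemma mem_distinct_parts m s : (s \in distinct_parts m) =
  [&& sorted (fun a b => b < a) s, all (fun x => x %% 3 != 0) s & head 0 s <= m].
Proof.
elim: m s => [|m IH] s /=.
  by rewrite inE; case: s => [|[|x] s] //=; rewrite ?andbF.
rewrite mem_cat IH.
have -> : (s \in if m.+1 %% 3 == 0 then [::] else map (cons m.+1) (distinct_parts m))
  = [&& m.+1 %% 3 != 0, head 0 s == m.+1 & behead s \in distinct_parts m].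
  case: ifP => // _; apply/mapP/idP => [[s' s'm ->]|]; first by rewrite /= eqxx.
  by case: s => [|x s] //= /andP[/eqP-> sm]; exists s.
case: s => [|x s] //=.
rewrite IH.
have -> : path (fun a b => b < a) x s =
  sorted (fun a b => b < a) s && ((s == [::]) || (head 0 s < x)).
  by case: s => //= y s; rewrite andbC.
(* The default 0 of [head] lets the empty tail satisfy every upper bound. *)
have : (s == [::]) ==> (head 0 s == 0) by case: s.
move: (sorted _ s) (all _ s) (s == [::]) (head 0 s) => A B C d.
by have [->|] := eqVneq x m.+1; case: A B C => [] [] []; lia.
Qed.

Lemma distinct_parts_uniq m : uniq (distinct_parts m).
Proof.
elim: m => //= m IH; case: ifP => _; first by rewrite cats0.
rewrite cat_uniq IH map_inj_uniq ?IH /= ?andbT; last by move=> s1 s2 [].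
apply/hasPn=> s /mapP[s' _ ->].
by rewrite mem_distinct_parts /= ltnn !andbF.
Qed.

(** * Generating functions and the recurrences of period 6 *)

Local Open Scope ring_scope.

Section GeneratingFunctions.
Variable R : comNzRingType.
Implicit Types a b q : R.

Definition weightD a b q (s : seq (nat * bool)) : R :=
  a ^+ stat_u s * b ^+ stat_v s * q ^+ sumn (map fst s).

Definition weightC a b q (s : seq nat) : R :=
  a ^+ count (fun m => m %% 3 == 1)%N s * b ^+ count (fun m => m %% 3 == 2)%N s
  * q ^+ sumn s.

Definition genD a b q (m : nat) : R := \sum_(s <- chains m) weightD a b q s.

Definition genC a b q (m : nat) : R := \sum_(s <- distinct_parts m) weightC a b q s.

Lemma weightD_cons a b q p s :
  weightD a b q (p :: s) = weightD a b q [:: p] * weightD a b q s.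
Proof.
rewrite /weightD.
have -> : stat_u (p :: s) = (stat_u [:: p] + stat_u s)%N by rewrite /stat_u /=; lia.
have -> : stat_v (p :: s) = (stat_v [:: p] + stat_v s)%N by rewrite /stat_v /=; lia.
have -> : sumn (map fst (p :: s)) = (sumn (map fst [:: p]) + sumn (map fst s))%N.
  by rewrite /= addn0.
by rewrite !exprD; ring.
Qed.

Lemma genD0 a b q : genD a b q 0 = 1.
Proof. by rewrite /genD /chains /= big_seq1 /weightD /=; ring. Qed.

Lemma genDS a b q m : genD a b q m.+1 =
  genD a b q m
  + (if overlinable m then weightD a b q [:: (m, true)] * genD a b q (m - 6) else 0)
  + weightD a b q [:: (m.+1, false)]
    * genD a b q (m.+1 - gap (m.+1, false)).
Proof.
rewrite /genD chainsS !big_cat /= addrA big_map; congr (_ + _ + _).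
  case: ifP => _; last by rewrite big_nil.
  by rewrite big_map mulr_sumr; apply: eq_bigr => s _; apply: weightD_cons.
by rewrite mulr_sumr; apply: eq_bigr => s _; apply: weightD_cons.
Qed.

(* At [j = 0] the truncated index [6 * j - 1] is 0, and [genD] is 1 there, as it should
   be for an empty range of parts. *)
Lemma genDS_recs a b q j : let G i := genD a b q (6 * j + i) in
  let Q := q ^+ (6 * j) in let G_1 := genD a b q (6 * j - 1) in
  (G 4%N = G 3%N + a * q ^+ 4 * Q * G_1)
  * (G 5%N = G 4%N + b * q ^+ 5 * Q * G 1%N)
  * (G 6%N = G 5%N + a ^+ 2 * q ^+ 5 * Q * G_1 + a * b * q ^+ 6 * Q * G 1%N)
  * (G 7%N = G 6%N + a * q ^+ 7 * Q * G 3%N)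
  * (G 8%N = G 7%N + b ^+ 2 * q ^+ 7 * Q * G 1%N + b * q ^+ 8 * Q * G 4%N)
  * (G 9%N = G 8%N + a * b * q ^+ 9 * Q * G 5%N)
  * (G 10%N = G 9%N + a * q ^+ 10 * Q * G 5%N)
  * (G 11%N = G 10%N + b * q ^+ 11 * Q * G 7%N).
Proof.
have mod6 i : (6 * j + i = i %[mod 6])%N by rewrite mulnC modnMDl.
have mod3 i : (6 * j + i = i %[mod 3])%N.
  by rewrite -[6%N]/(2 * 3)%N mulnAC modnMDl.
have E i := genDS a b q (6 * j + i).
have ltn6 i : (1 < i)%N -> (1 < 6 * j + i)%N by lia.
have addnB i k : (6 * j + (k + i) - k = 6 * j + i)%N by lia.
have addnB1 i : (6 * j + i - i.+1 = 6 * j - 1)%N by lia.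
rewrite /=.
do !split; [move: (E 3%N)|move: (E 4%N)|move: (E 5%N)|move: (E 6%N)
  |move: (E 7%N)|move: (E 8%N)|move: (E 9%N)|move: (E 10%N)].
all: rewrite -addnS /overlinable /weightD /stat_u /stat_v /gap /= !mod6 !mod3 /=.
all: rewrite ?addn0 ?muln0 ?muln1 ?andbF ?andbT.
all: rewrite ?ltn6 // ?(addnB1, addnB 1 4, addnB 1 5, addnB 3 4, addnB 1 6,
  addnB 4 4, addnB 5 4, addnB 5 5, addnB 7 4)%N //= => ->; rewrite !(exprD _ (6 * j)).
all: by move: (q ^+ (6 * j)) => Q; ring.
Qed.

Definition genD_step a b q m := (1 + a * q) * genD (b * q) (a * q ^+ 2) q m.

(* The first and third relations are there to close the induction. *)
Lemma genD_step_recs a b q j :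
  let G i := genD a b q (6 * j + i) in
  [/\ G 1%N = genD_step a b q (6 * j - 1),
      G 3%N = genD_step a b q (6 * j + 1)
    & genD_step a b q (6 * j + 3) = G 4%N + a * q * (G 5%N - G 3%N)].
Proof.
rewrite /= /genD_step; elim: j => [|j].
  have G1 c d : genD c d q 1 = 1 + c * q.
    by rewrite genDS genD0 /weightD /stat_u /stat_v /=; ring.
  have G2 c d : genD c d q 2 = 1 + c * q + d * q ^+ 2.
    by rewrite genDS G1 genD0 /weightD /stat_u /stat_v /=; ring.
  have G3 c d : genD c d q 3 = 1 + c * q + d * q ^+ 2 + c * d * q ^+ 3.
    by rewrite genDS G2 genD0 /weightD /stat_u /stat_v /=; ring.
  have [[[[[[[E4 E5] _] _] _] _] _] _] := genDS_recs a b q 0.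
  move: E4 E5; rewrite /= !muln0 /= !add0n sub0n => -> ->.
  by rewrite !genD0 !G1 !G3; split; ring.
(* The recurrences are needed at both argument pairs: [x] below stands for [(a, b)], [y] for
   [(b * q, a * q ^+ 2)]. *)
have [[[[[[[]]]]]]] := genDS_recs (b * q) (a * q ^+ 2) q j.
have [[[[[[[]]]]]]] := genDS_recs a b q j.
have idx i : (6 * j.+1 + i = 6 * j + (6 + i))%N by lia.
have -> : (6 * j.+1 - 1 = 6 * j + 5)%N by lia.
rewrite !idx !addSn !add0n.
pose x i := genD a b q (6 * j + i).
pose y i := genD (b * q) (a * q ^+ 2) q (6 * j + i).
rewrite -!/(x _) -!/(y _).
move: (q ^+ (6 * j)) (genD a b q (6 * j - 1)) => Q x_1.
move: (genD (b * q) (a * q ^+ 2) q (6 * j - 1)) => y_1.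
move=> x4E x5E x6E x7E x8E x9E x10E x11E y4E y5E y6E y7E y8E y9E _ _ [x1E x3E y3E].
(* Elimination by [xE] and [yE] leaves only [x_1], [y_1], [y 1] and [y 3], tied by the single linear
   relation [y3E]. Each goal is then a multiple of that relation. *)
have lin c (l r : R) :
    l - r = c * ((1 + a * q) * y 3%N - (x 4%N + a * q * (x 5%N - x 3%N))) -> l = r.
  by rewrite y3E subrr mulr0 => /eqP; rewrite subr_eq0 => /eqP.
have xE := (x11E, x10E, x9E, x8E, x7E, x6E, x5E, x4E, x3E, x1E).
have yE := (y9E, y8E, y7E, y6E, y5E, y4E).
(* In each goal the factor passed to [lin] is the coefficient of [(1 + a * q) * y 3]. *)
split.
- by apply: (lin (-1)); rewrite !(xE, yE); ring.
- by apply: (lin (- (1 + b * q ^+ 8 * Q))); rewrite !(xE, yE); ring.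
- apply: (lin (1 + b * q ^+ 8 * Q + a * q ^+ 10 * Q + a * b * q ^+ 12 * Q)).
  by rewrite !(xE, yE); ring.
Qed.

(** * Congruences modulo powers of [q] and the infinite iteration *)

(** Congruence modulo the ideal generated by [q ^+ N]; it replaces limits of power series and makes
    sense in any commutative ring. *)
Definition eq_mod_pow q N (x y : R) := exists c, x = y + q ^+ N * c.

Lemma eq_mod_pow_refl q N x : eq_mod_pow q N x x.
Proof. by exists 0; rewrite mulr0 addr0. Qed.

Lemma eq_mod_pow_sym q N x y : eq_mod_pow q N x y -> eq_mod_pow q N y x.
Proof. by case=> c ->; exists (- c); ring. Qed.

Lemma eq_mod_pow_trans q N x y z :
  eq_mod_pow q N x y -> eq_mod_pow q N y z -> eq_mod_pow q N x z.
Proof. by case=> c -> [d ->]; exists (c + d); ring. Qed.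

Lemma eq_mod_pow_mull q N x y z : eq_mod_pow q N x y -> eq_mod_pow q N (z * x) (z * y).
Proof. by case=> c ->; exists (z * c); ring. Qed.

(** Every sequence added at this stage contains a part [m] or [m.+1], hence has weight divisible by
    [q ^+ m]. *)
Lemma genDS_mod a b q m : eq_mod_pow q m (genD a b q m.+1) (genD a b q m).
Proof.
rewrite genDS {1 2}/weightD /= !addn0 exprS.
case: ifP => _.
  eexists; rewrite -addrA; congr (_ + _).
  by rewrite !mulrA -!(mulrC (q ^+ m)) -!mulrA -mulrDr.
by eexists; rewrite addr0; congr (_ + _); rewrite !mulrA -!(mulrC (q ^+ m)) -!mulrA.
Qed.

Lemma genD_mod a b q N m : (N <= m)%N -> eq_mod_pow q N (genD a b q m) (genD a b q N).
Proof.
elim: m => [|m IH]; first by rewrite leqn0 => /eqP->; apply: eq_mod_pow_refl.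
rewrite leq_eqVlt => /orP[/eqP->|Nm]; first exact: eq_mod_pow_refl.
apply: eq_mod_pow_trans (IH Nm).
have [c ->] := genDS_mod a b q m; exists (q ^+ (m - N) * c).
by rewrite mulrA -exprD subnKC.
Qed.

(** A part that counts in [stat_u] or [stat_v] brings a factor [a] or [b], each scaled here by
    [q ^+ N]. *)
Lemma weightD_mod0 a b q N p : (0 < stat_u [:: p] + stat_v [:: p])%N ->
  exists c, weightD (a * q ^+ N) (b * q ^+ N) q [:: p] = q ^+ N * c.
Proof.
rewrite /weightD; case: (stat_u _) (stat_v _) (sumn _) => [|i] [|j] k // _.
- by exists (b * (b * q ^+ N) ^+ j * q ^+ k); rewrite exprS; ring.
- by exists (a * (a * q ^+ N) ^+ i * q ^+ k); rewrite exprS; ring.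
- exists (a * (a * q ^+ N) ^+ i * (b * q ^+ N) ^+ j.+1 * q ^+ k).
  by rewrite exprS; ring.
Qed.

(** Every admissible part counts in [stat_u] or [stat_v], so modulo [q ^+ N] only the empty sequence
    survives. *)
Lemma genD_mod1 a b q N m :
  eq_mod_pow q N (genD (a * q ^+ N) (b * q ^+ N) q m) 1.
Proof.
elim: m => [|m IH]; first by rewrite genD0; apply: eq_mod_pow_refl.
apply: eq_mod_pow_trans IH; rewrite genDS.
have [|c ->] := weightD_mod0 a b q N (m.+1, false).
  by rewrite /stat_u /stat_v /=; lia.
case: ifP => om; last by eexists; rewrite addr0 -mulrA.
have [|d ->] := weightD_mod0 a b q N (m, true).
  by move: om; rewrite /overlinable /stat_u /stat_v /=; lia.
by eexists; rewrite -addrA -!mulrA -mulrDr.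
Qed.

Lemma genCS a b q m : genC a b q m.+1 =
  genC a b q m * (if (m.+1 %% 3 == 0)%N then 1 else 1 + weightC a b q [:: m.+1]).
Proof.
rewrite /genC /= big_cat /=; case: ifP => _; first by rewrite big_nil; ring.
rewrite big_map mulrDr mulr1 mulr_suml; congr (_ + _).
by apply: eq_bigr => s _; rewrite /weightC /= !addn0 !exprD; ring.
Qed.

Lemma genC_mul3S a b q k : genC a b q (3 * k.+1) =
  genC a b q (3 * k) * (1 + a * q ^+ (3 * k + 1)) * (1 + b * q ^+ (3 * k + 2)).
Proof.
have mod3 i : (3 * k + i = i %[mod 3])%N by rewrite mulnC modnMDl.
have E i : genC a b q (3 * k + i.+1) = genC a b q (3 * k + i)
    * (if (i.+1 %% 3 == 0)%N then 1 else 1 + weightC a b q [:: (3 * k + i.+1)%N]).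
  by rewrite addnS genCS -addnS mod3.
rewrite mulnSr (E 2%N) (E 1%N) (E 0%N) addn0 /weightC /= !mod3 /= !addn0.
by rewrite !exprD; move: (q ^+ (3 * k)) => Q; ring.
Qed.

(** The exact identity is applied twice, since one application exchanges the roles of the variables:
    [(a, b)] goes to [(b q, a q^2)], then to [(a q^3, b q^3)]. *)
Lemma genD_mod_step a b q N :
  let F c d := genD c d q (6 * N + 3) in
  eq_mod_pow q N (F a b) ((1 + a * q) * (1 + b * q ^+ 2) * F (a * q ^+ 3) (b * q ^+ 3)).
Proof.
have half c d : eq_mod_pow q N (genD c d q (6 * N + 3))
    ((1 + c * q) * genD (d * q) (c * q ^+ 2) q (6 * N + 3)).
  have [_ -> _] := genD_step_recs c d q N; apply: eq_mod_pow_mull.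
  (* The identity lowers the index to [6 * N + 1]; both indices are at least [N], so passing through
     index [N] restores [6 * N + 3]. *)
  apply: (@eq_mod_pow_trans _ _ _ (genD (d * q) (c * q ^+ 2) q N)).
    by apply: genD_mod; lia.
  by apply/eq_mod_pow_sym/genD_mod; lia.
apply: (eq_mod_pow_trans _ _ _ _ _ (half a b)).
have := eq_mod_pow_mull _ _ _ _ (1 + a * q) (half (b * q) (a * q ^+ 2)).
have -> : a * q ^+ 2 * q = a * q ^+ 3 by ring.
have -> : b * q * q ^+ 2 = b * q ^+ 3 by ring.
have -> : b * q * q = b * q ^+ 2 by ring.
by rewrite mulrA.
Qed.

Lemma genD_genC a b q N :
  eq_mod_pow q N (genD a b q (6 * N + 3)) (genC a b q (3 * N)).
Proof.
have iter j : eq_mod_pow q N (genD a b q (6 * N + 3))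
    (genC a b q (3 * j) * genD (a * q ^+ (3 * j)) (b * q ^+ (3 * j)) q (6 * N + 3)).
  elim: j => [|j IH].
    rewrite muln0 /genC /= big_seq1 /weightC /= !expr0 !mulr1 mul1r.
    exact: eq_mod_pow_refl.
  apply: eq_mod_pow_trans IH _.
  have := eq_mod_pow_mull _ _ _ _ (genC a b q (3 * j))
    (genD_mod_step (a * q ^+ (3 * j)) (b * q ^+ (3 * j)) q N).
  by rewrite genC_mul3S mulnSr !exprD expr1 !mulrA.
apply: eq_mod_pow_trans (iter N) _.
rewrite -[X in eq_mod_pow _ _ _ X]mulr1; apply: eq_mod_pow_mull.
(* One factor [q ^+ N] is kept as the scaling of [genD_mod1]; the other [q ^+ (2 * N)] is absorbed
   into its [a] and [b]. *)
have -> : (3 * N = 2 * N + N)%N by lia.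
by rewrite !exprD !mulrA; apply: genD_mod1.
Qed.

End GeneratingFunctions.

(** * Extraction of coefficients *)

(** In the nested polynomial ring the outermost variable marks [n], the middle one [v] and the
    innermost one [u]. *)
Lemma coef_sum_monomials (T : Type) (L : seq T) (fu fv fn : T -> nat) (u v n : nat) :
  (\sum_(s <- L) ('X%:P)%:P ^+ fu s * 'X%:P ^+ fv s * 'X ^+ fn s
     : {poly {poly {poly int}}})`_n`_v`_u
  = (count (fun s => [&& fu s == u, fv s == v & fn s == n]) L)%:R.
Proof.
elim: L => [|s L IH] /=; first by rewrite big_nil !coef0.
rewrite big_cons !coefD IH natrD; congr (_ + _).
rewrite -!rmorphXn -rmorphM /= coefCM coefXn.
rewrite -polyC_natr coefMC coefCM coefXn -mulrA -natrM mulr_natr coefMn coefXn.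
rewrite ![fn s == n]eq_sym ![fu s == u]eq_sym ![fv s == v]eq_sym.
by do 3 case: eqP.
Qed.

Lemma count_chains_distinct_parts (u v n : nat) :
  count (fun s => [&& stat_u s == u, stat_v s == v & sumn (map fst s) == n])
    (chains (6 * n.+1 + 3))
  = count (fun s : seq nat => [&& count (fun m => m %% 3 == 1)%N s == u,
                        count (fun m => m %% 3 == 2)%N s == v & sumn s == n])
    (distinct_parts (3 * n.+1)).
Proof.
(* Precision [n.+1] keeps the error term out of the coefficient of degree [n]. Integer coefficients
   let the counts be recovered from their images. *)
have [c] := genD_genC {poly {poly {poly int}}} ('X%:P)%:P 'X%:P 'X n.+1.
move/(congr1 (fun p : {poly {poly {poly int}}} => p`_n`_v`_u)).
rewrite coefD coefXnM ltnSn addr0 !coef_sum_monomials => /eqP.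
by rewrite Num.Theory.eqr_nat => /eqP.
Qed.

Local Close Scope ring_scope.

(** * Identification of [C3] and [D3] with the list counts *)

Lemma leq_mem_sumn (s : seq nat) x : x \in s -> x <= sumn s.
Proof.
elim: s => //= y s IH; rewrite inE => /predU1P[->|/IH]; first exact: leq_addr.
by move/leq_trans; apply; apply: leq_addl.
Qed.

Lemma size_leq_sumn (s : seq nat) : all (leq 1) s -> size s <= sumn s.
Proof. by elim: s => //= x s IH /andP[x0 /IH]; lia. Qed.

Lemma C3E (u v n : nat) : C3 u v n =
  count (fun s : seq nat => [&& count (fun m => m %% 3 == 1) s == u,
                        count (fun m => m %% 3 == 2) s == v & sumn s == n])
    (distinct_parts (3 * n.+1)).
Proof.
rewrite /C3 (sum_card_tuple _ _ _ (is_C3 u v n) (distinct_parts (3 * n.+1)) n val_inj).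
- apply: eq_in_count => s; rewrite mem_distinct_parts => /and3P[s1 s2 _].
  by rewrite /is_C3 s1 s2.
- exact: distinct_parts_uniq.
(* Parts drawn from ['I_n.+1] are at most [n], well below the bound [3 * n.+1] of the list. *)
- move=> t; rewrite mem_distinct_parts => /and3P[-> -> _] /=.
  by case: t => //= i t; have := ltn_ord i; lia.
move=> s _ /and5P[_ s0 _ _ /eqP <-]; split.
  by apply: size_leq_sumn; apply: sub_all s0 => -[].
exists (map inord s); rewrite -map_comp map_id_in // => x xs /=.
by rewrite inordK // ltnS leq_mem_sumn.
Qed.

Lemma D3E (u v n : nat) : D3 u v n =
  count (fun s => [&& stat_u s == u, stat_v s == v & sumn (map fst s) == n])
    (chains (6 * n.+1 + 3)).
Proof.
have is_D3E s : is_D3 u v n s = gap_chain s &&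
    [&& stat_u s == u, stat_v s == v & sumn (map fst s) == n].
  rewrite gap_chainE /is_D3 -/(stat_u s) -/(stat_v s).
  move: (is_overpartition s) (all _ s) (_ \notin s) (sorted _ s) => A B C D.
  by move: (_ == u) (_ == v) (_ == n); case: A B C D => [] [] [] [] [] [] [].
pose f (p : 'I_n.+1 * bool) := (val p.1, p.2).
have f_inj : injective f by move=> [i b] [j c] [/val_inj-> ->].
rewrite /D3 (sum_card_tuple _ _ f (is_D3 u v n) (chains (6 * n.+1 + 3)) n f_inj).
- by apply: eq_in_count => s; rewrite mem_chains is_D3E => /andP[-> _].
- exact: chains_uniq.
- move=> t; rewrite is_D3E mem_chains => /andP[-> _] /=.
  by case: t => //= -[i b] t; have := ltn_ord i; case: b; rewrite /= /chi; lia.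
move=> s _; rewrite is_D3E gap_chainE /is_overpartition.
case/andP=> /andP[/andP[s0 _] _] /and3P[_ _ /eqP sn]; split.
  rewrite -(size_map fst) -sn size_leq_sumn // all_map.
  by apply: sub_all s0.
exists (map (fun p => (inord p.1, p.2)) s); rewrite -map_comp map_id_in //.
move=> [x b] xs /=; rewrite /f /= inordK // ltnS -sn leq_mem_sumn //.
exact: (map_f fst xs).
Qed.

Theorem theorem1p10 (u v n : nat) : C3 u v n = D3 u v n.
Proof. by rewrite C3E D3E count_chains_distinct_parts. Qed.
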